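(* For every finite simple graph $G$, the following statements are equivalent: (i) $G$ is a $2$-probe complete graph; (ii) $G$ is $\{P_4,\ 2K_2,\ K_3+K_1,\ (K_2+K_1)\star 2K_1,\ 2K_1\star 2K_1\star 2K_1\}$-free; (iii) $G$ is a $(K,X,Y,Z)$-graph.
   Context: Graphs are finite and simple. For a graph class $\mathcal{C}$ and an integer $k\ge 1$, a graph $G=(V,E)$ is a $k$-probe $\mathcal{C}$ graph if there exist independent sets $N_1,\dots,N_k\subseteq V$ (possibly empty) and a graph $G'=(V,E')\in\mathcal{C}$ with $E\subseteq E'$ such that for every edge $xy\in E'\setminus E$ there is an $i$ with $x,y\in N_i$. A $2$-probe complete graph is a $2$-probe $\mathcal{C}$ graph where $\mathcal{C}$ is the class of complete graphs. $G+H$ denotes the disjoint union, $2G=G+G$, and the join $G\star H$ is obtained from $G+H$ by adding all edges between a vertex of $G$ and a vertex of $H$. $K_n$ is the complete graph and $P_n$ the path on $n$ vertices. A graph is $\mathcal{F}$-free if it has no induced subgraph isomorphic to a member of $\mathcal{F}$. A vertex is universal if it is adjacent to all other vertices. A graph $G=(V,E)$ is a $(K,X,Y,Z)$-graph if $V$ can be partitioned into disjoint (possibly empty) sets $K,X,Y,Z$ such that $K$ is the set of all universal vertices of $G$, $X\cup Z$ and $Y\cup Z$ are independent sets, and every vertex of $X$ is adjacent to every vertex of $Y$. *)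

(* Defs.v *)
From mathcomp Require Import all_boot.
From Stdlib Require List.

Set Implicit Arguments.
Unset Strict Implicit.
Unset Printing Implicit Defensive.

Record sgraph := SGraph {
  vertex :> finType;
  edge : rel vertex;
  edge_sym : symmetric edge;
  edge_irr : irreflexive edge
}.

Definition complete_rel n : rel 'I_n := fun i j => i != j.

Lemma complete_sym n : symmetric (@complete_rel n).
Proof. by move=> i j; rewrite /complete_rel eq_sym. Qed.

Lemma complete_irr n : irreflexive (@complete_rel n).
Proof. by move=> i; rewrite /complete_rel eqxx. Qed.

Definition complete_graph n : sgraph :=
  SGraph (@complete_sym n) (@complete_irr n).

Definition path_rel n : rel 'I_n :=
  fun i j => (i.+1 == j :> nat) || (j.+1 == i :> nat).

Lemma path_sym n : symmetric (@path_rel n).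
Proof. by move=> i j; rewrite /path_rel orbC. Qed.

Lemma path_irr n : irreflexive (@path_rel n).
Proof. by move=> i; rewrite /path_rel orbb gtn_eqF. Qed.

Definition path_graph n : sgraph := SGraph (@path_sym n) (@path_irr n).

Section Operations.
Variables G H : sgraph.

Definition union_rel : rel (G + H)%type := fun u v =>
  match u, v with
  | inl x, inl y => edge x y
  | inr x, inr y => edge x y
  | _, _ => false
  end.

Lemma union_sym : symmetric union_rel.
Proof. by case=> x [] y //=; rewrite edge_sym. Qed.

Lemma union_irr : irreflexive union_rel.
Proof. by case=> x /=; rewrite edge_irr. Qed.

Definition gunion : sgraph := SGraph union_sym union_irr.

Definition join_rel : rel (G + H)%type := fun u v =>
  match u, v with
  | inl _, inr _ | inr _, inl _ => true
  | _, _ => union_rel u v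
  end.

Lemma join_sym : symmetric join_rel.
Proof. by case=> x [] y //=; rewrite edge_sym. Qed.

Lemma join_irr : irreflexive join_rel.
Proof. by case=> x /=; rewrite edge_irr. Qed.

Definition gjoin : sgraph := SGraph join_sym join_irr.

Definition isomorphic : Prop :=
  exists2 f : G -> H, bijective f & {mono f : x y / edge x y}.

End Operations.

Definition gdouble (G : sgraph) : sgraph := gunion G G.

Section Graph.
Variable G : sgraph.
Implicit Types (S K X Y Z : {set G}) (x y : G).

Definition induced_rel S : rel {x : G | x \in S} :=
  fun u v => edge (val u) (val v).

Lemma induced_sym S : symmetric (@induced_rel S).
Proof. by move=> u v; rewrite /induced_rel edge_sym. Qed.

Lemma induced_irr S : irreflexive (@induced_rel S).
Proof. by move=> u; rewrite /induced_rel edge_irr. Qed.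

Definition induced S : sgraph := SGraph (@induced_sym S) (@induced_irr S).

Definition free_of (F : seq sgraph) : Prop :=
  forall H : sgraph, List.In H F -> ~ exists S, isomorphic (induced S) H.

Definition independent S : bool :=
  [forall x in S, forall y in S, ~~ edge x y].

Definition universal x : bool := [forall y, (y != x) ==> edge x y].

Definition is_complete : Prop := forall x y, x != y -> edge x y.

Definition partition4 K X Y Z : Prop :=
  [/\ K :|: X :|: Y :|: Z = [set: G],
      [/\ [disjoint K & X], [disjoint K & Y] & [disjoint K & Z]]
    & [/\ [disjoint X & Y], [disjoint X & Z] & [disjoint Y & Z]]].

Definition KXYZ_graph : Prop :=
  exists K X Y Z,
    [/\ partition4 K X Y Z,
        K = [set x | universal x],
        independent (X :|: Z),
        independent (Y :|: Z)
      & {in X & Y, forall x y, edge x y}].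

End Graph.

(* [SGraph sE' iE'] is the supergraph G' = (V, E') on the vertex set of [G]. *)
Definition probe (k : nat) (C : sgraph -> Prop) (G : sgraph) : Prop :=
  exists (N : 'I_k -> {set G}) (E' : rel G)
         (sE' : symmetric E') (iE' : irreflexive E'),
    [/\ forall i, independent (N i),
        C (SGraph sE' iE'),
        subrel (@edge G) E'
      & forall x y, E' x y -> ~~ edge x y ->
          exists i, x \in N i /\ y \in N i].

Definition forbidden_graphs : seq sgraph :=
  let K := complete_graph in
  [:: path_graph 4;
      gdouble (K 2);
      gunion (K 3) (K 1);
      gjoin (gunion (K 2) (K 1)) (gdouble (K 1));
      gjoin (gjoin (gdouble (K 1)) (gdouble (K 1))) (gdouble (K 1))].

(* Main.v *)
Require Import Defs.
From mathcomp Require Import all_boot.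

(** Call two distinct non-adjacent vertices co-adjacent.  A 2-probe complete
    graph is one whose co-edges are covered by two independent sets [A] and
    [B]; setting [K] apart, these are [X :|: Z] and [Y :|: Z].  Such covers
    restrict to induced subgraphs, and none of the five forbidden graphs has
    one.  Conversely, in a graph without the forbidden subgraphs the
    non-universal vertices span no triangle: co-neighbours of its three vertices
    would always produce one of the five graphs.  If [xy] is an edge between
    non-universal vertices, take for [X] and [Y] the non-universal neighbours of
    [y] and of [x]; excluding triangles, [P_4] and [2K_2] gives the rest. *)

Set Implicit Arguments.
Unset Strict Implicit.
Unset Printing Implicit Defensive.

(** * Induced subgraphs as embeddings *)

Definition embedding (H G : sgraph) (f : H -> G) : Prop :=
  injective f /\ {mono f : x y / edge x y}.

Lemma induced_embedding (H G : sgraph) :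
  (exists S : {set G}, isomorphic (induced S) H) <->
  (exists f : H -> G, embedding f).
Proof.
split=> [[S [g [h gK hK] gE]]|[f [fI fE]]].
  exists (val \o h); split=> [x y /val_inj /(can_inj hK) //|x y].
  by rewrite -[in RHS](hK x) -[in RHS](hK y) gE.
exists [set f x | x in H].
pose F (x : H) : induced [set f x | x in H] :=
  exist _ (f x) (imset_f f (erefl true : x \in H)).
have FI : injective F by move=> x y /(congr1 val) /fI.
have Fsurj (u : induced [set f x | x in H]) : exists x, F x == u.
  case: u => u uS; have /imsetP[x _ ux] := uS.
  by exists x; apply/eqP/val_inj.
(* [isomorphic] runs from the induced subgraph to [H], against the direction of [f], so an inverse
   of [F] is chosen. *)
pose g u := xchoose (Fsurj u).
have gK : cancel g F by move=> u; apply/eqP/(xchooseP (Fsurj u)).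
exists g => [|u v]; first by exists F => // x; apply: FI; rewrite gK.
by rewrite -fE -[in RHS](gK u) -[in RHS](gK v).
Qed.

(** * Co-adjacency and the assembly of embeddings *)

Section Coadjacency.
Variable G : sgraph.

Definition coedge (x y : G) : bool := (x != y) && ~~ edge x y.

Lemma coedge_sym : symmetric coedge.
Proof. by move=> x y; rewrite /coedge eq_sym edge_sym. Qed.

Lemma edge_neq (x y : G) : edge x y -> x != y.
Proof. by apply: contraTneq => ->; rewrite edge_irr. Qed.

Lemma edge_coedge (x y : G) : edge x y -> coedge x y = false.
Proof. by rewrite /coedge => ->; rewrite andbF. Qed.

Lemma nonuniversalP (x : G) :
  reflect (exists y, coedge x y) (~~ universal x).
Proof.
rewrite negb_forall; apply: (iffP existsP) => -[y].
  by rewrite negb_imply eq_sym => ?; exists y.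
by rewrite /coedge eq_sym => ?; exists y; rewrite negb_imply.
Qed.

(** Recording a list that contains the image turns the conditions for unions and joins into
    conditions on pairs of listed vertices. *)
Definition embeds_in (H : sgraph) (s : seq G) : Prop :=
  exists2 f : H -> G, embedding f & forall v, f v \in s.

Lemma embeds_in_nth n (e : rel 'I_n) (se : symmetric e) (ie : irreflexive e)
    (s : n.-tuple G) :
  uniq s -> (forall i j : 'I_n, edge (tnth s i) (tnth s j) = e i j) ->
  embeds_in (SGraph se ie) s.
Proof.
move=> /tuple_uniqP us es; exists (tnth s : SGraph se ie -> G) => [|i].
  by split.
exact: mem_tnth.
Qed.

Lemma embeds_in_complete (s : seq G) :
  pairwise (@edge G) s -> embeds_in (complete_graph (size s)) s.
Proof.
move=> ps; rewrite -[X in embeds_in _ X]/(tval (in_tuple s)).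
apply: embeds_in_nth; first exact: pairwise_uniq (@edge_irr G) ps.
case: s ps => [_ []//|x0 s /(pairwiseP x0) ps] i j.
rewrite /complete_rel !(tnth_nth x0) /= -(inj_eq val_inj) /=.
have ps' (u v : 'I_(size (x0 :: s))) :
    u < v -> edge (nth x0 (x0 :: s) u) (nth x0 (x0 :: s) v).
  by apply: ps; rewrite -topredE /=.
by case: ltngtP => [/ps'|/ps'|->]; rewrite ?edge_irr // edge_sym.
Qed.

(** Injectivity across the two summands needs distinct images, hence [coedge] and not mere
    non-adjacency; for joins, adjacency already gives distinctness. *)
Lemma embeds_in_union (H1 H2 : sgraph) (s1 s2 : seq G) :
  embeds_in H1 s1 -> embeds_in H2 s2 -> allrel coedge s1 s2 ->
  embeds_in (gunion H1 H2) (s1 ++ s2).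
Proof.
move=> [f [fI fE] fs] [g [gI gE] gs] /allrelP st.
have fg x y : f x != g y /\ edge (f x) (g y) = false.
  by have /andP[-> /negbTE ->] := st _ _ (fs x) (gs y).
exists (fun v : gunion H1 H2 => match v with inl x => f x | inr y => g y end).
  split=> [[x|x] [y|y] /= eq|[x|x] [y|y] /=]; last first.
  - exact: gE.
  - by rewrite edge_sym (fg y x).2.
  - by rewrite (fg x y).2.
  - exact: fE.
  - by rewrite (gI _ _ eq).
  - by case/eqP: (fg y x).1.
  - by case/eqP: (fg x y).1.
  - by rewrite (fI _ _ eq).
by case=> v; rewrite mem_cat ?fs ?gs ?orbT.
Qed.

Lemma embeds_in_join (H1 H2 : sgraph) (s1 s2 : seq G) :
  embeds_in H1 s1 -> embeds_in H2 s2 -> allrel (@edge G) s1 s2 ->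
  embeds_in (gjoin H1 H2) (s1 ++ s2).
Proof.
move=> [f [fI fE] fs] [g [gI gE] gs] /allrelP st.
have fg x y : edge (f x) (g y) := st _ _ (fs x) (gs y).
exists (fun v : gjoin H1 H2 => match v with inl x => f x | inr y => g y end).
  split=> [[x|x] [y|y] /= eq|[x|x] [y|y] /=]; last first.
  - exact: gE.
  - by rewrite edge_sym fg.
  - by rewrite fg.
  - exact: fE.
  - by rewrite (gI _ _ eq).
  - by case/eqP: (edge_neq (fg y x)).
  - by case/eqP: (edge_neq (fg x y)).
  - by rewrite (fI _ _ eq).
by case=> v; rewrite mem_cat ?fs ?gs ?orbT.
Qed.

(** * Triangles in graphs without the forbidden subgraphs *)

Section Free.
Hypothesis freeG : free_of G forbidden_graphs.

Lemma free_embeds_in (H : sgraph) (s : seq G) :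
  List.In H forbidden_graphs -> ~ embeds_in H s.
Proof.
by move=> inH [f fH _]; apply: (freeG inH); apply/induced_embedding; exists f.
Qed.

Lemma embeds_in_2K1 (x y : G) :
  coedge x y -> embeds_in (gdouble (complete_graph 1)) [:: x; y].
Proof.
move=> xy; apply: (@embeds_in_union _ _ [:: x] [:: y]).
- exact: (@embeds_in_complete [:: x]).
- exact: (@embeds_in_complete [:: y]).
by rewrite /allrel /= xy.
Qed.

Lemma P4_free (a b c d : G) : edge a b -> edge b c -> edge c d ->
  coedge a c -> coedge a d -> ~ coedge b d.
Proof.
move=> ab bc cd ac ad bd.
suff: embeds_in (path_graph 4) [tuple a; b; c; d].
  by move=> emb; apply: free_embeds_in emb; left.
have [[ab' bc'] cd'] := (edge_neq ab, edge_neq bc, edge_neq cd).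
move: ac ad bd => /andP[ac' ac] /andP[ad' ad] /andP[bd' bd].
apply: embeds_in_nth; first by rewrite /= !inE !negb_or ab' ac' ad' bc' bd' cd'.
move=> i j; rewrite !(tnth_nth a).
case: i => -[|[|[|[|//]]]] ? ; case: j => -[|[|[|[|//]]]] ?;
  rewrite /path_rel /= ?edge_irr // ?ab ?bc ?cd ?(negbTE ac) ?(negbTE ad) ?(negbTE bd) //;
  by rewrite edge_sym ?ab ?bc ?cd ?(negbTE ac) ?(negbTE ad) ?(negbTE bd).
Qed.

Lemma twoK2_free (a b c d : G) : edge a b -> edge c d ->
  coedge a c -> coedge a d -> coedge b c -> ~ coedge b d.
Proof.
move=> ab cd ac ad bc bd.
suff: embeds_in (gdouble (complete_graph 2)) ([:: a; b] ++ [:: c; d]).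
  by move=> emb; apply: free_embeds_in emb; right; left.
apply: embeds_in_union; last by rewrite /allrel /= ac ad bc bd.
- by apply: (@embeds_in_complete [:: a; b]); rewrite /= ab.
- by apply: (@embeds_in_complete [:: c; d]); rewrite /= cd.
Qed.

Lemma K3_K1_free (a b c d : G) : edge a b -> edge b c -> edge a c ->
  coedge d a -> coedge d b -> ~ coedge d c.
Proof.
move=> ab bc ac da db dc.
suff: embeds_in (gunion (complete_graph 3) (complete_graph 1)) ([:: a; b; c] ++ [:: d]).
  by move=> emb; apply: free_embeds_in emb; do 2!right; left.
apply: embeds_in_union; last by rewrite /allrel /= -!(coedge_sym d) da db dc.
- by apply: (@embeds_in_complete [:: a; b; c]); rewrite /= ab ac bc.
- exact: (@embeds_in_complete [:: d]).
Qed.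

Lemma K2_K1_join_2K1_free (a b w c d : G) :
  edge a b -> coedge w a -> coedge w b -> coedge c d ->
  ~ allrel (@edge G) [:: a; b; w] [:: c; d].
Proof.
move=> ab wa wb cd abwcd.
suff: embeds_in (gjoin (gunion (complete_graph 2) (complete_graph 1))
        (gdouble (complete_graph 1))) ([:: a; b; w] ++ [:: c; d]).
  by move=> emb; apply: free_embeds_in emb; do 3!right; left.
apply: embeds_in_join => //; last exact: embeds_in_2K1.
apply: (@embeds_in_union _ _ [:: a; b] [:: w]).
- by apply: (@embeds_in_complete [:: a; b]); rewrite /= ab.
- exact: (@embeds_in_complete [:: w]).
by rewrite /allrel /= -!(coedge_sym w) wa wb.
Qed.

Lemma octahedron_free (a a' b b' c c' : G) :
  coedge a a' -> coedge b b' -> coedge c c' ->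
  allrel (@edge G) [:: a; a'] [:: b; b'] ->
  ~ allrel (@edge G) [:: a; a'; b; b'] [:: c; c'].
Proof.
move=> aa bb cc ab abc.
suff: embeds_in (gjoin (gjoin (gdouble (complete_graph 1)) (gdouble (complete_graph 1)))
        (gdouble (complete_graph 1))) ([:: a; a'; b; b'] ++ [:: c; c']).
  by move=> emb; apply: free_embeds_in emb; do 4!right; left.
apply: embeds_in_join => //; last exact: embeds_in_2K1.
by apply: (@embeds_in_join _ _ [:: a; a'] [:: b; b']) => //; exact: embeds_in_2K1.
Qed.

Lemma edgeNcoedge (x y : G) : x != y -> edge x y = ~~ coedge x y.
Proof. by rewrite /coedge => ->; rewrite negbK. Qed.

(** Otherwise [w] sees [c], as $K_3+K_1$ is excluded. Let [d] be a co-neighbour of [c]. If [d] sees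
    all of [a], [b], [w], these five vertices induce $(K_2+K_1)\star 2K_1$; if it sees neither [a]
    nor [b], there is a $K_3+K_1$; every other case gives a $P_4$. *)
Lemma triangle_coedge (a b c w : G) : edge a b -> edge b c -> edge a c ->
  ~~ universal c -> coedge w a -> ~~ coedge w b.
Proof.
move=> ab bc ac /nonuniversalP[d cd] wa; apply/negP=> wb.
have [ba cb ca] : [/\ edge b a, edge c b & edge c a] by split; rewrite edge_sym.
have wc : edge w c.
  rewrite edgeNcoedge; first by apply/negP; exact: K3_K1_free ab bc ac wa wb.
  by apply: contraTneq wa => ->; rewrite edge_coedge.
have cw : edge c w by rewrite edge_sym.
have dc : coedge d c by rewrite coedge_sym.
(* A neighbour of [c] differs from [d], so it is co-adjacent to [d] as soon as it is not adjacent to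
   it. *)
have Ew x : edge c x -> coedge d x = ~~ edge d x.
  move=> cx; rewrite /coedge.
  case: eqP => // dx; by move: cd; rewrite dx (edge_coedge cx).
have [da|] := boolP (edge d a); last rewrite -Ew // => da.
  have [db|] := boolP (edge d b); last rewrite -Ew // => db.
    have [dw|] := boolP (edge d w); last rewrite -Ew // => dw.
      case: (K2_K1_join_2K1_free ab wa wb cd).
      by rewrite /allrel /= ac bc wc !(@edge_sym G _ d) da db dw.
    by case: (P4_free da ac cw dc dw); rewrite coedge_sym.
  have [dw|] := boolP (edge d w); last rewrite -Ew // => dw.
    by case: (P4_free dw wc cb dc db).
  case: (@P4_free w c a d wc ca) => //; first by rewrite edge_sym.
  by rewrite coedge_sym.
have [db|] := boolP (edge d b); last rewrite -Ew // => db.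
  have [dw|] := boolP (edge d w); last rewrite -Ew // => dw.
    by case: (P4_free dw wc ca dc da).
  case: (@P4_free w c b d wc cb) => //; first by rewrite edge_sym.
  by rewrite coedge_sym.
by case: (K3_K1_free ab bc ac da db).
Qed.

(** Choose a co-neighbour of each vertex of the triangle. Each of them sees the other two triangle
    vertices ([T]), and any two of them are adjacent ([Q]), so the six vertices form $2K_1\star
    2K_1\star 2K_1$. *)
Lemma nonuniversal_triangle_free (a b c : G) :
  ~~ universal a -> ~~ universal b -> ~~ universal c ->
  edge a b -> edge b c -> ~~ edge a c.
Proof.
move=> na nb nc ab bc; apply/negP=> ac.
have [ba cb ca] : [/\ edge b a, edge c b & edge c a] by split; rewrite edge_sym.
have [[/nonuniversalP[a' aa] /nonuniversalP[b' bb]] /nonuniversalP[c' cc]] := (na, nb, nc).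
have T x y z w : edge x y -> edge y z -> edge x z -> ~~ universal z ->
    coedge x w -> edge y w.
  move=> xy yz xz nz xw; rewrite edgeNcoedge.
    by rewrite coedge_sym; apply: triangle_coedge xy yz xz nz _; rewrite coedge_sym.
  by apply: contraTneq xw => <-; rewrite edge_coedge.
(* Otherwise [x'], [y], [x], [y'] would be an induced $P_4$. *)
have Q x y x' y' : edge x y -> coedge x x' -> coedge y y' ->
    edge y x' -> edge x y' -> edge x' y'.
  move=> xy xx yy yx' xy'; rewrite edgeNcoedge.
    apply/negP => xy''.
    case: (@P4_free x' y x y'); rewrite // 1?edge_sym //.
    by rewrite coedge_sym.
  by apply: contraTneq xx => ->; rewrite edge_coedge.
have [ba' ca'] := (T _ _ c _ ab bc ac nc aa, T _ _ b _ ac cb ab nb aa).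
have [ab' cb'] := (T _ _ c _ ba ac bc nc bb, T _ _ a _ bc ca ba na bb).
have [ac' bc'] := (T _ _ b _ ca ab cb nb cc, T _ _ a _ cb ba ca na cc).
case: (@octahedron_free a a' b b' c c' aa bb cc);
  rewrite /allrel /= ?ab ?ab' ?ac ?ac' ?bc ?bc' ?(edge_sym _ b) ?(edge_sym _ c) ?ba' ?ca' ?cb' /=.
  by rewrite (Q a b).
by rewrite (Q a c) // (Q b c).
Qed.

End Free.

End Coadjacency.

(** * Covers of the co-edges by two independent sets *)

Definition coclique_cover (G : sgraph) (A B : {set G}) : Prop :=
  forall x y, x != y ->
    edge x y = ~~ ((x \in A) && (y \in A) || (x \in B) && (y \in B)).

(** The supergraph must be the complete graph on the same vertices, so the added edges are exactly
    the co-edges. In [coclique_cover], one direction of the equation makes both sets independent and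
    the other covers every co-edge. *)
Lemma probe2_complete (G : sgraph) :
  probe 2 is_complete G <-> exists A B, @coclique_cover G A B.
Proof.
split=> [[N [E' [sE' [iE' [Nind E'c _ E'N]]]]]|[A [B AB]]].
  exists (N ord0), (N ord_max) => x y xy; apply/idP/idP => [exy|].
    rewrite negb_or; apply/andP; split; apply/negP => /andP[xN yN].
      by move/forall_inP: (Nind ord0) => /(_ x xN) /forall_inP /(_ y yN); rewrite exy.
    by move/forall_inP: (Nind ord_max) => /(_ x xN) /forall_inP /(_ y yN); rewrite exy.
  apply: contraR => nxy; have [i [xi yi]] := E'N _ _ (E'c _ _ xy) nxy.
  have [i0|i1] : i = ord0 \/ i = ord_max.
    by case: i {xi yi} => -[|[|//]] ?; [left|right]; apply: val_inj.
  - by rewrite -i0; apply/orP; left; apply/andP.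
  - by rewrite -i1; apply/orP; right; apply/andP.
exists (fun i => if i == ord0 then A else B), (fun x y => x != y).
exists (fun x y => congr1 negb (eq_sym x y)), (fun x => congr1 negb (eqxx x)).
split=> // [i|x y|x y xy].
- apply/forall_inP => x xN; apply/forall_inP => y yN.
  have [->|xy] := eqVneq x y; first by rewrite edge_irr.
  by move: xN yN; rewrite AB //; case: ifP => _ -> ->; rewrite ?orbT.
- exact: edge_neq.
by rewrite AB // negbK => /orP[/andP[xA yA]|/andP[xB yB]];
   [exists ord0 | exists ord_max].
Qed.

(** From left to right the cover is [X :|: Z], [Y :|: Z]. Conversely, [X], [Y], [Z] are the regions
    [A] only, [B] only and both, with universal vertices taken out: such a vertex can lie in a
    covering set, for instance in a singleton [A]. *)
Lemma KXYZ_cover (G : sgraph) :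
  KXYZ_graph G <-> exists A B, @coclique_cover G A B.
Proof.
split=> [[K [X [Y [Z [[KXYZ _ _] KE XZ YZ XY]]]]]|[A [B AB]]].
  exists (X :|: Z), (Y :|: Z) => x y xy; apply/idP/idP => [exy|].
    rewrite negb_or; apply/andP; split; apply/negP => /andP[xN yN].
      by move/forall_inP: XZ => /(_ x xN) /forall_inP /(_ y yN); rewrite exy.
    by move/forall_inP: YZ => /(_ x xN) /forall_inP /(_ y yN); rewrite exy.
  have uE u v : u \in K -> u != v -> edge u v.
    by rewrite KE inE eq_sym => /forall_inP; apply.
  have [xK|xK] := boolP (x \in K); first by rewrite uE.
  have [yK|yK] := boolP (y \in K); first by rewrite edge_sym uE // eq_sym.
  have /setP/(_ x) := KXYZ; have /setP/(_ y) := KXYZ.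
  rewrite !inE (negbTE xK) (negbTE yK) /=.
  (* The cases that survive have one vertex in [X] and the other in [Y]. *)
  case yX: (y \in X) => /=; case yY: (y \in Y) => /=; case yZ: (y \in Z) => //= _;
  case xX: (x \in X) => /=; case xY: (x \in Y) => /=; case xZ: (x \in Z) => //= _ _;
  by [apply: XY | rewrite edge_sym; apply: XY].
pose K := [set x : G | universal x].
have ABind (C : {set G}) : C = A \/ C = B -> forall x y, x \in C -> y \in C -> ~~ edge x y.
  move=> CAB x y xC yC; have [->|xy] := eqVneq x y; first by rewrite edge_irr.
  by rewrite AB // negbK; case: CAB => <-; rewrite xC yC ?orbT.
exists K, [set x | [&& x \in A, x \notin B & x \notin K]],
  [set x | [&& x \notin A, x \in B & x \notin K]],
  [set x | [&& x \in A, x \in B & x \notin K]].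
(* A vertex outside both sets lies on no co-edge. *)
have uK x : x \notin A -> x \notin B -> x \in K.
  move=> /negbTE xA /negbTE xB; rewrite inE; apply/forall_inP => y.
  by rewrite eq_sym => xy; rewrite AB // xA xB.
split=> //.
- split; first apply/setP => x.
  + by rewrite [RHS]inE !(in_setU, in_set); have := uK x; rewrite inE;
      case: (x \in A) => //=; case: (x \in B) => //=; case: (universal x) => //= ->.
  + by split; rewrite disjoint_subset; apply/subsetP => x; rewrite !inE => ->; rewrite ?andbF.
  + by split; rewrite disjoint_subset; apply/subsetP => x; rewrite !inE => /and3P[];
      do ![move=> ->| move=> /negbTE ->].
- apply/forall_inP => x; rewrite !inE => xA; apply/forall_inP => y; rewrite !inE => yA.
  apply: (ABind A); first by left.
    by case/orP: xA => /andP[].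
  by case/orP: yA => /andP[].
- apply/forall_inP => x; rewrite !inE => xA; apply/forall_inP => y; rewrite !inE => yA.
  apply: (ABind B); first by right.
    by case/orP: xA => /and3P[].
  by case/orP: yA => /and3P[].
move=> x y; rewrite !inE => /and3P[xA /negbTE xB _] /and3P[/negbTE yA yB _].
rewrite AB ?yA ?xB ?andbF //.
by apply: contraFneq yA => <-.
Qed.

(** * The forbidden graphs have no cover *)

Lemma coclique_cover_embedding (H G : sgraph) (f : H -> G) (A B : {set G}) :
  embedding f -> coclique_cover A B ->
  coclique_cover (f @^-1: A) (f @^-1: B).
Proof. by move=> [fI fE] AB x y xy; rewrite !inE -fE AB ?inj_eq. Qed.

(** An edge between two vertex pairs prevents them from lying in the same independent set. *)
Definition linked (G : sgraph) (s t : seq G) : bool :=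
  has (fun x => has (@edge G x) t) s.

(* By pigeonhole two of the three co-edges lie in the same independent set. *)
Lemma linked_coedges_no_cover (G : sgraph) (a a' b b' c c' : G)
    (A B : {set G}) :
  coedge a a' -> coedge b b' -> coedge c c' ->
  linked [:: a; a'] [:: b; b'] -> linked [:: a; a'] [:: c; c'] ->
  linked [:: b; b'] [:: c; c'] -> ~ coclique_cover A B.
Proof.
move=> aa bb cc ab ac bc AB.
have cov x y : coedge x y -> all (mem A) [:: x; y] \/ all (mem B) [:: x; y].
  by move=> /andP[xy]; rewrite AB // negbK /= !andbT => /orP[]; [left|right].
have lA s t : linked s t -> all (mem A) s -> ~ all (mem A) t.
  move=> /hasP[x xs /hasP[y yt exy]] /allP/(_ x xs) /= xA /allP/(_ y yt) /= yA.
  by have := exy; rewrite AB ?edge_neq // xA yA.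
have lB s t : linked s t -> all (mem B) s -> ~ all (mem B) t.
  move=> /hasP[x xs /hasP[y yt exy]] /allP/(_ x xs) /= xB /allP/(_ y yt) /= yB.
  by have := exy; rewrite AB ?edge_neq // xB yB orbT.
case: (cov _ _ aa) (cov _ _ bb) (cov _ _ cc) => sa [] sb [] sc;
  by [apply: lA ab sa sb | apply: lA ac sa sc | apply: lA bc sb sc
     |apply: lB ab sa sb | apply: lB ac sa sc | apply: lB bc sb sc].
Qed.

(** Each graph has three pairwise linked co-edges, possibly sharing vertices: all three co-edges of
    $P_4$, three of the four in $2K_2$, those at the isolated vertex of $K_3+K_1$, those of
    $K_2+K_1$ together with the pair $2K_1$, and the three antipodal pairs of the octahedron. *)
Lemma forbidden_cover (H : sgraph) (A B : {set H}) :
  List.In H forbidden_graphs -> ~ coclique_cover A B.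
Proof.
pose k n i (lt_in : i < n) : complete_graph n := Ordinal lt_in.
case=> [eqH|[eqH|[eqH|[eqH|[eqH|[]]]]]]; subst H.
- pose v i (lt_i4 : i < 4) : path_graph 4 := Ordinal lt_i4.
  exact: (@linked_coedges_no_cover _ (v 0 isT) (v 2 isT)
    (v 0 isT) (v 3 isT) (v 1 isT) (v 3 isT)).
- pose u i (lt_i2 : i < 2) : gdouble (complete_graph 2) := inl (k 2 i lt_i2).
  pose v i (lt_i2 : i < 2) : gdouble (complete_graph 2) := inr (k 2 i lt_i2).
  exact: (@linked_coedges_no_cover _ (u 0 isT) (v 0 isT)
    (u 0 isT) (v 1 isT) (u 1 isT) (v 0 isT)).
- pose u i (lt_i3 : i < 3) : gunion (complete_graph 3) (complete_graph 1) :=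
    inl (k 3 i lt_i3).
  pose d : gunion (complete_graph 3) (complete_graph 1) := inr (k 1 0 isT).
  exact: (@linked_coedges_no_cover _ d (u 0 isT) d (u 1 isT) d (u 2 isT)).
- pose J := gjoin (gunion (complete_graph 2) (complete_graph 1))
    (gdouble (complete_graph 1)).
  pose u i (lt_i2 : i < 2) : J := inl (inl (k 2 i lt_i2)).
  pose w : J := inl (inr (k 1 0 isT)).
  pose c : J := inr (inl (k 1 0 isT)); pose c' : J := inr (inr (k 1 0 isT)).
  exact: (@linked_coedges_no_cover J w (u 0 isT) w (u 1 isT) c c').
pose D := gdouble (complete_graph 1); pose J := gjoin (gjoin D D) D.
pose x : D := inl (k 1 0 isT); pose y : D := inr (k 1 0 isT).
exact: (@linked_coedges_no_cover J (inl (inl x)) (inl (inl y))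
  (inl (inr x)) (inl (inr y)) (inr x) (inr y)).
Qed.

Lemma cover_free (G : sgraph) (A B : {set G}) :
  coclique_cover A B -> free_of G forbidden_graphs.
Proof.
move=> AB H inH /induced_embedding[f fH].
exact: forbidden_cover inH (coclique_cover_embedding fH AB).
Qed.

(** * Construction of a cover *)

Lemma free_cover (G : sgraph) :
  free_of G forbidden_graphs -> exists A B, @coclique_cover G A B.
Proof.
move=> fG; pose U := [set x : G | ~~ universal x].
have uE u v : u != v -> u \notin U -> edge u v.
  by rewrite inE negbK eq_sym => uv /forall_inP; apply.
have [/existsP[x /existsP[y /and3P[xU yU xy]]]|noedge] :=
    boolP [exists x, exists y, [&& x \in U, y \in U & edge x y]]; last first.
  exists U, set0 => x y xy; rewrite !in_set0 orbF.
  have [xU|xU] := boolP (x \in U); last by rewrite uE.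
  have [yU|yU] := boolP (y \in U); last by rewrite edge_sym uE // eq_sym.
  apply: contraNF noedge => exy; apply/existsP; exists x; apply/existsP; exists y.
  by rewrite xU yU.
have yx : edge y x by rewrite edge_sym.
have tri a b c : a \in U -> b \in U -> c \in U -> edge a b -> edge b c -> ~~ edge a c.
  by rewrite !inE; exact: (nonuniversal_triangle_free fG).
(* Of two edges inside [U], each end of one sees an end of the other. If [a] sees neither [c] nor
   [d], then an edge from [b] to one of them gives a $P_4$, its last chord being excluded by [tri],
   and no such edge gives a $2K_2$. *)
have edgeN a b c d : a \in U -> b \in U -> c \in U -> d \in U ->
    edge a b -> edge c d -> ~~ edge a c -> edge a d.
  move=> aU bU cU dU ab cd nac; apply: contraT => nad.
  have co : coedge a c /\ coedge a d.
    rewrite /coedge nac nad !andbT; split.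
      by apply: contraNneq nad => ->.
    by apply: contraNneq nac => ->; rewrite edge_sym.
  have [bc|nbc] := boolP (edge b c).
    case: (P4_free fG ab bc cd co.1 co.2).
    by rewrite /coedge (tri b c d) // andbT; apply: contraNneq nad => <-.
  have [bd|nbd] := boolP (edge b d).
    have dc : edge d c by rewrite edge_sym.
    case: (P4_free fG ab bd dc co.2 co.1).
    by rewrite /coedge nbc andbT; apply: contraNneq nac => <-.
  case: (@twoK2_free _ fG a b c d ab cd co.1 co.2).
    by rewrite /coedge nbc andbT; apply: contraNneq nac => <-.
  by rewrite /coedge nbd andbT; apply: contraNneq nad => <-.
(* On the path [c], [a], [b], [d] the chords [cb] and [ad] would close triangles, so only [cd] can
   prevent an induced $P_4$. *)
have edgeP a b c d : a \in U -> b \in U -> c \in U -> d \in U ->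
    edge a b -> edge c a -> edge b d -> c != d -> edge c d.
  move=> aU bU cU dU ab ca bd cd; apply: contraT => ncd.
  have cb : coedge c b.
    by rewrite /coedge (tri c a b) // andbT; apply: contraNneq ncd => ->.
  case: (@P4_free _ fG c a b d ca ab bd cb).
    by rewrite /coedge cd.
  by rewrite /coedge (tri a b d) // andbT; apply: contraNneq ncd => <-.
(* The non-neighbours of [x] in [U], among them [x] itself, form [X :|: Z]: by [tri], no neighbour
   of [y] in [U] sees [x]. Symmetrically, those of [y] form [Y :|: Z]. *)
exists [set u in U | ~~ edge x u], [set u in U | ~~ edge y u] => u v uv.
(* This unfolds the two covering sets but keeps membership in [U] folded for the case analysis. *)
have inE' w z : (z \in [set u in U | ~~ edge w u]) = (z \in U) && ~~ edge w z.
  exact: in_set.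
rewrite !{}inE'.
have [uU|uU] := boolP (u \in U); last by rewrite uE.
have [vU|vU] := boolP (v \in U); last by rewrite edge_sym uE 1?eq_sym // !andbF.
rewrite /=; apply/idP/idP => [euv|].
  have nbr z t : z \in U -> t \in U -> edge z t -> edge z u || edge z v.
    move=> zU tU zt; have [//|zu] := boolP (edge z u).
    by apply: edgeN zt euv zu.
  by rewrite negb_or !negb_and !negbK (nbr x y) // (nbr y x).
(* Both [x] and [y] see one of [u], [v]. Seeing the same one would close a triangle; seeing
   different ones yields a path with ends [u] and [v], to which [edgeP] applies. *)
rewrite negb_or !negb_and !negbK => /andP[/orP[xu|xv] /orP[yu|yv]].
- by have := tri x u y xU uU yU xu; rewrite (edge_sym u) yu xy => /(_ isT).
- by apply: (edgeP x y); rewrite // edge_sym.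
- by apply: (edgeP y x); rewrite // edge_sym.
- by have := tri x v y xU vU yU xv; rewrite (edge_sym v) yv xy => /(_ isT).
Qed.

Theorem theorem4 (G : sgraph) :
  (probe 2 is_complete G <-> free_of G forbidden_graphs) /\
  (free_of G forbidden_graphs <-> KXYZ_graph G).
Proof.
have coverP : (exists A B, @coclique_cover G A B) <-> free_of G forbidden_graphs.
  by split=> [[A [B]]|]; [apply: cover_free | apply: free_cover].
by split; [rewrite probe2_complete | rewrite KXYZ_cover]; rewrite coverP.
Qed.
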